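(* The proof system $\mathbf{EMC}^\circ$ is sound and strongly complete with respect to the class of $(mc)$-frames.
   Context: Fix a nonempty set $\mathbf{P}$ of propositional variables, $p\in\mathbf{P}$. $\mathcal{L}(\bullet)$: $\varphi::=p\mid\neg\varphi\mid\varphi\land\varphi\mid\bullet\varphi$; other Boolean connectives are defined as usual and $\circ\varphi$ abbreviates $\neg\bullet\varphi$. A neighborhood frame is $\langle S,N\rangle$ with $S$ a nonempty set and $N:S\to\mathcal{P}(\mathcal{P}(S))$; a model $\mathcal{M}=\langle S,N,V\rangle$ based on it adds $V:\mathbf{P}\to\mathcal{P}(S)$. With $\varphi^{\mathcal{M}}=\{s\in S\mid\mathcal{M},s\vDash\varphi\}$: $\mathcal{M},s\vDash p$ iff $s\in V(p)$; Boolean connectives as usual; $\mathcal{M},s\vDash\bullet\varphi$ iff $s\in\varphi^{\mathcal{M}}$ and $\varphi^{\mathcal{M}}\notin N(s)$. An $(mc)$-frame is one where, for all $s\in S$: $(m)$ $X\in N(s)$ and $X\subseteq Y\subseteq S$ imply $Y\in N(s)$; and $(c)$ $X,Y\in N(s)$ imply $X\cap Y\in N(s)$. The proof system $\mathbf{EMC}^\circ$ for $\mathcal{L}(\bullet)$ has as axioms all instances of propositional tautologies and all instances of $\circ\texttt{E}$: $\bullet\varphi\to\varphi$; $\circ\texttt{M}$: $\circ\varphi\land\varphi\to\circ(\varphi\lor\psi)$; $\circ\texttt{C}$: $\circ\varphi\land\circ\psi\to\circ(\varphi\land\psi)$; its rules are modus ponens and $\texttt{RE}\circ$: from $\varphi\leftrightarrow\psi$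 infer $\circ\varphi\leftrightarrow\circ\psi$ (applied to theorems). Sound with respect to a class of frames: every theorem is true at every state of every model based on a frame in the class. Strongly complete: for every set $\Gamma\cup\{\varphi\}$ of formulas, if $\varphi$ is true at every state, in every model based on a frame in the class, at which all of $\Gamma$ is true, then $\vdash\bigwedge\Gamma_0\to\varphi$ for some finite $\Gamma_0\subseteq\Gamma$ (equivalently, every consistent set is satisfiable in a model based on a frame in the class). *)

(* Defs.v *)
From Stdlib Require List.
From mathcomp Require Import all_boot.
From mathcomp Require Import classical_sets.

Set Implicit Arguments.
Unset Strict Implicit.
Unset Printing Implicit Defensive.

Local Open Scope classical_set_scope.

Inductive form (P : Type) : Type :=
| Var (p : P)
| Neg (a : form P)
| And (a b : form P)
| Bullet (a : form P).

Definition Or (P : Type) (a b : form P) : form P := Neg (And (Neg a) (Neg b)).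
Definition Imp (P : Type) (a b : form P) : form P := Neg (And a (Neg b)).
Definition Iff (P : Type) (a b : form P) : form P := And (Imp a b) (Imp b a).
Definition Circ (P : Type) (a : form P) : form P := Neg (Bullet a).

(* The language has no constants: Top is built from a variable [p], which
   exists because the set of variables is nonempty. *)
Definition Top (P : Type) (p : P) : form P := Imp (Var p) (Var p).

Definition BigAnd (P : Type) (p : P) (G : seq (form P)) : form P :=
  foldr (@And P) (Top p) G.

Record frame : Type := Frame {
  state : Type;
  state_nonempty : inhabited state;
  nbhd : state -> set (set state) }.

Definition mc_frame (F : frame) : Prop :=
  forall s : state F,
    (forall X Y : set (state F), nbhd s X -> X `<=` Y -> nbhd s Y) /\
    (forall X Y : set (state F), nbhd s X -> nbhd s Y -> nbhd s (X `&` Y)).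

Record model (P : Type) : Type := Model {
  model_frame :> frame;
  valuation : P -> set (state model_frame) }.
Arguments valuation {P} m p.

Fixpoint sat (P : Type) (M : model P) (a : form P) (s : state M) : Prop :=
  match a with
  | Var p => valuation M p s
  | Neg b => ~ sat b s
  | And b c => sat b s /\ sat c s
  | Bullet b => sat b s /\ ~ nbhd s [set t | sat b t]
  end.

(* Propositional formulas over schematic letters.  The letters are natural
   numbers, not elements of [P], since [P] may be too small: over a single
   variable, [p /\ q -> p] would not be available as a schema. *)
Inductive pform : Type :=
| PLetter (n : nat)
| PNeg (t : pform)
| PAnd (t u : pform).

Fixpoint peval (v : nat -> bool) (t : pform) : bool :=
  match t with
  | PLetter n => v n
  | PNeg u => ~~ peval v u
  | PAnd u w => peval v u && peval v w
  end.

Definition tautology (t : pform) : Prop := forall v : nat -> bool, peval v t.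

Fixpoint psubst (P : Type) (f : nat -> form P) (t : pform) : form P :=
  match t with
  | PLetter n => f n
  | PNeg u => Neg (psubst f u)
  | PAnd u w => And (psubst f u) (psubst f w)
  end.

Inductive EMC (P : Type) : form P -> Prop :=
| EMC_taut (t : pform) (f : nat -> form P) : tautology t -> EMC (psubst f t)
| EMC_E (a : form P) : EMC (Imp (Bullet a) a)
| EMC_M (a b : form P) : EMC (Imp (And (Circ a) a) (Circ (Or a b)))
| EMC_C (a b : form P) :
    EMC (Imp (And (Circ a) (Circ b)) (Circ (And a b)))
| EMC_MP (a b : form P) : EMC (Imp a b) -> EMC a -> EMC b
| EMC_RE (a b : form P) : EMC (Iff a b) -> EMC (Iff (Circ a) (Circ b)).

Definition sound (P : Type) (thm : form P -> Prop) (C : frame -> Prop) : Prop :=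
  forall a : form P, thm a ->
  forall M : model P, C M -> forall s : state M, sat a s.

Definition entails (P : Type) (C : frame -> Prop)
    (G : set (form P)) (a : form P) : Prop :=
  forall M : model P, C M -> forall s : state M,
    (forall g : form P, G g -> sat g s) -> sat a s.

Definition strongly_complete (P : Type) (p : P) (thm : form P -> Prop)
    (C : frame -> Prop) : Prop :=
  forall (G : set (form P)) (a : form P), entails C G a ->
  exists G0 : seq (form P),
    (forall g : form P, List.In g G0 -> G g) /\ thm (Imp (BigAnd p G0) a).

(* Main.v *)
From mathcomp Require Import all_boot.
From mathcomp Require Import boolp classical_sets.
Require Import Defs.

Set Implicit Arguments.
Unset Strict Implicit.
Unset Printing Implicit Defensive.

Local Open Scope classical_set_scope.

(** Completeness goes through the canonical model whose states are the maximal
    consistent sets and in which [X] is a neighborhood of [s] when [X] includes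
    the proof set [|a|] of some [a] such that both [a] and [Circ a] are in [s].
    Upward closure is built in, and closure under intersection is axiom C.  In
    the truth lemma, [|b|] included in [|a|] yields the theorem [b -> a], so
    that [Or b a] is equivalent to [a], and M with RE carry [Circ b] over to
    [Circ a]. *)

Lemma sat_imp (P : Type) (M : model P) (s : state M) a b :
  sat (Imp a b) s <-> (sat a s -> sat b s).
Proof.
split=> [/= nab sa|ab /= [sa]]; last by apply; apply: ab.
by apply: contrapT => nb; apply: nab.
Qed.

Lemma sat_circ (P : Type) (M : model P) (s : state M) a :
  sat (Circ a) s <-> (sat a s -> nbhd s [set t | sat a t]).
Proof.
split=> [/= nB sa|aN /= [sa]]; last by apply; apply: aN.
by apply: contrapT => nN; apply: nB.
Qed.

Lemma emc_sound (P : Type) : sound (@EMC P) mc_frame.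
Proof.
move=> a; elim=> {a} [t f tP|a|a b|a b|a b _ IHab _ IHa|a b _ IHab] M MC s.
(* The state [s] induces a Boolean valuation of the letters, under which the tautology evaluates to
   true. *)
- have evalE (u : pform) :
      sat (psubst f u) s <-> peval (fun n => `[< sat (f n) s >]) u.
    elim: u => [n|u IHu|u IHu w IHw] /=.
    + by split=> /asboolP.
    + by rewrite IHu; split=> /negP.
    + by rewrite IHu IHw; split=> /andP.
  exact/evalE/tP.
- by apply/sat_imp => -[].
- apply/sat_imp => -[/sat_circ aN sa]; apply/sat_circ => _.
  by apply: (proj1 (MC s)) (aN sa) _ => t ta [].
- apply/sat_imp => -[/sat_circ aN /sat_circ bN]; apply/sat_circ => -[sa sb].
  exact: (proj2 (MC s)) (aN sa) (bN sb).
- exact: (proj1 (sat_imp _ _ _) (IHab M MC s)) (IHa M MC s).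
- have abE (t : state M) : sat a t <-> sat b t.
    by have [/sat_imp ab /sat_imp ba] := IHab M MC t.
  have sabE : [set t : state M | sat a t] = [set t | sat b t].
    by apply/seteqP; split=> t /abE.
  by split; apply/sat_imp => /sat_circ cN; apply/sat_circ => /abE /cN;
    rewrite sabE.
Qed.

Section Tautologies.
Variable P : Type.
Implicit Types a b c : form P.

Local Notation X := (PLetter 0).
Local Notation Y := (PLetter 1).
Local Notation Z := (PLetter 2).
Local Notation pImp t u := (PNeg (PAnd t (PNeg u))).

(** The schemas below use only the letters 0, 1 and 2, so eight Boolean cases decide each of them; a
    schema with fewer letters repeats an argument. *)
Ltac taut t a b c :=
  apply: (@EMC_taut P t (nth a [:: a; b; c]));
  let v := fresh "v" in move=> v /=; by case: (v 0); case: (v 1); case: (v 2).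

Lemma emc_id a : EMC (Imp a a).
Proof. taut (pImp X X) a a a. Qed.

Lemma emc_const a b : EMC (Imp a (Imp b a)).
Proof. taut (pImp X (pImp Y X)) a b b. Qed.

Lemma emc_distr a b c : EMC (Imp (Imp a (Imp b c)) (Imp (Imp a b) (Imp a c))).
Proof.
taut (pImp (pImp X (pImp Y Z)) (pImp (pImp X Y) (pImp X Z))) a b c.
Qed.

Lemma emc_explode a b : EMC (Imp (Neg a) (Imp a b)).
Proof. taut (pImp (PNeg X) (pImp X Y)) a b b. Qed.

Lemma emc_cases a b : EMC (Imp (Imp a b) (Imp (Imp (Neg a) b) b)).
Proof. taut (pImp (pImp X Y) (pImp (pImp (PNeg X) Y) Y)) a b b. Qed.

Lemma emc_andl a b : EMC (Imp (And a b) a).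
Proof. taut (pImp (PAnd X Y) X) a b b. Qed.

Lemma emc_andr a b : EMC (Imp (And a b) b).
Proof. taut (pImp (PAnd X Y) Y) a b b. Qed.

Lemma emc_and a b : EMC (Imp a (Imp b (And a b))).
Proof. taut (pImp X (pImp Y (PAnd X Y))) a b b. Qed.

Lemma emc_or_absorb a b : EMC (Imp (Imp a b) (Iff (Or a b) b)).
Proof.
taut (pImp (pImp X Y) (PAnd (pImp (PNeg (PAnd (PNeg X) (PNeg Y))) Y)
                            (pImp Y (PNeg (PAnd (PNeg X) (PNeg Y)))))) a b b.
Qed.

End Tautologies.

(* RE is available for theorems only: it enters through [der_thm]. *)
Inductive der (P : Type) (G : set (form P)) : form P -> Prop :=
| der_thm a : EMC a -> der G a
| der_hyp a : G a -> der G a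
| der_mp a b : der G (Imp a b) -> der G a -> der G b.

Lemma der_cut (P : Type) (G H : set (form P)) a :
  G `<=` der H -> der G a -> der H a.
Proof.
move=> GH; elim=> {a} [a aP|a /GH //|a b _ ab _ ha]; first exact: der_thm.
exact: der_mp ab ha.
Qed.

Lemma der_mono (P : Type) (G H : set (form P)) a :
  G `<=` H -> der G a -> der H a.
Proof. by move=> GH; apply: der_cut => b /GH; apply: der_hyp. Qed.

Lemma der_set0 (P : Type) (a : form P) : der set0 a -> EMC a.
Proof. by elim=> {a} // a b _ ab _; apply: EMC_MP ab. Qed.

(** Modus ponens is the only rule that acts on hypotheses, so every step of the derivation can be
    prefixed by [a]. *)
Lemma deduction (P : Type) (G : set (form P)) a b :
  der (a |` G) b -> der G (Imp a b).
Proof.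
have weaken c : der G c -> der G (Imp a c).
  by apply/der_mp/der_thm/emc_const.
elim=> {b} [b bP|b [->|Gb]|b c _ IHbc _ IHb].
- exact/weaken/der_thm.
- exact/der_thm/emc_id.
- exact/weaken/der_hyp.
- exact: der_mp (der_mp (der_thm _ (emc_distr a b c)) IHbc) IHb.
Qed.

Lemma der_finite (P : Type) (G : set (form P)) a : der G a ->
  exists2 L : seq (form P),
    [set b | List.In b L] `<=` G & der [set b | List.In b L] a.
Proof.
elim=> {a} [a aP|a Ga|a b _ [L LG La] _ [K KG Kb]].
- by exists [::] => //; apply: der_thm.
- by exists [:: a]; [move=> b [<-|] | apply: der_hyp; left].
- exists (L ++ K) => [c /(@List.in_app_or _ _ _ _)[/LG|/KG] //|].
  apply: der_mp.
  + by apply: der_mono La => c Lc; apply: List.in_or_app; left.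
  + by apply: der_mono Kb => c Kc; apply: List.in_or_app; right.
Qed.

Lemma emc_BigAnd (P : Type) (p : P) (L : seq (form P)) a :
  der [set b | List.In b L] a -> EMC (Imp (BigAnd p L) a).
Proof.
move=> La; apply/der_set0/deduction; apply: der_cut La => b.
(* After the cut, it remains to extract each member of [L] as a conjunct, by induction on [L]. *)
suff: EMC (Imp (BigAnd p L) b) \/ ~ List.In b L.
  by case=> // bP _; apply: der_mp (der_thm _ bP) _; apply: der_hyp; left.
elim: L => [|c L [IH|IH]]; [by right| |].
- left; apply: der_set0; apply: deduction; apply: der_mp (der_thm _ IH) _.
  by apply: der_mp (der_thm _ (emc_andr c _)) _; apply: der_hyp; left.
- have [cb|ncb] := pselect (c = b); last by right=> -[].
  by left; rewrite cb; apply: emc_andl.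
Qed.

(** Of two members of a chain, the larger serves both premises of a modus ponens. The first
    alternative covers derivations from [G] alone, the only ones when the chain is empty. *)
Lemma der_chain (P : Type) (G : set (form P)) (F : set (set (form P))) a :
  total_on F subset -> der (G `|` \bigcup_(A in F) A) a ->
  der G a \/ exists2 A, F A & der (G `|` A) a.
Proof.
move=> Ftot.
elim=> {a} [a aP|a [Ga|[A FA Aa]]|a b _ [ab|[A FA ab]] _ [da|[B FB da]]].
- by left; apply: der_thm.
- by left; apply: der_hyp.
- by right; exists A => //; apply: der_hyp; right.
- by left; apply: der_mp ab da.
- by right; exists B => //; apply: der_mp da; apply: der_mono ab => c; left.
- by right; exists A => //; apply: der_mp ab _; apply: der_mono da => c; left.
- right; have [AB|BA] := Ftot _ _ FA FB.
  + by exists B => //; apply: der_mp da; apply: der_mono ab; apply: setUS.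
  + by exists A => //; apply: der_mp ab _; apply: der_mono da; apply: setUS.
Qed.

(* Equivalent to maximal consistency. *)
Definition mcs (P : Type) (s : set (form P)) : Prop :=
  der s `<=` s /\ forall a, s (Neg a) <-> ~ s a.

Lemma lindenbaum (P : Type) (G : set (form P)) a : ~ der G a ->
  exists s, [/\ mcs s, G `<=` s & ~ s a].
Proof.
move=> nGa.
(* [G] is kept apart from [A] because the empty chain must satisfy the condition too, and its union
   is empty. *)
have [|A [nAa Amax]] := @Zorn_bigcup _ [set A | ~ der (G `|` A) a].
  move=> F FP Ftot /= /(der_chain Ftot) [//|[A /FP]]; exact.
(* Adding an underivable [b] enlarges [A] properly, so by maximality it makes [a] derivable. *)
have dmax b : ~ der (G `|` A) b -> der (G `|` A) (Imp b a).
  move=> nb; apply: deduction; rewrite setUCA; apply: contrapT.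
  apply: (Amax (b |` A)); split; first exact: subsetUr.
  by move=> /(_ b (or_introl erefl)) Ab; apply: nb; apply: der_hyp; right.
exists (der (G `|` A)); split=> [|b Gb|//]; last by apply: der_hyp; left.
split=> [b|b]; first by apply: der_cut.
split=> [dnb db|ndb].
  exact: nAa (der_mp (der_mp (der_thm _ (emc_explode b a)) dnb) db).
(* If [Neg b] were underivable as well, [a] would follow both from [b] and from [Neg b]. *)
apply: contrapT => /dmax dn.
exact: nAa (der_mp (der_mp (der_thm _ (emc_cases b a)) (dmax _ ndb)) dn).
Qed.

Section MaximalConsistent.
Variables (P : Type) (s : set (form P)).
Hypothesis sP : mcs s.

Lemma mcs_mp a b : EMC (Imp a b) -> s a -> s b.
Proof.
move=> ab sa; apply: (proj1 sP); apply: der_mp (der_thm _ ab) _.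
exact: der_hyp.
Qed.

Lemma mcs_and a b : s (And a b) <-> s a /\ s b.
Proof.
split=> [sab|[sa sb]].
  by split; apply: mcs_mp sab; [apply: emc_andl | apply: emc_andr].
apply: (proj1 sP); apply: der_mp (der_hyp sb); apply: der_mp (der_hyp sa).
exact/der_thm/emc_and.
Qed.

(** The premise [s a] matters: [Circ a] is true wherever [a] is false, so [Circ] by itself is not
    monotone. *)
Lemma mcs_circ_mono a b : EMC (Imp a b) -> s a -> s (Circ a) -> s (Circ b).
Proof.
move=> ab sa sCa.
have /EMC_RE /(EMC_MP (emc_andl _ _)) : EMC (Iff (Or a b) b).
  exact: EMC_MP (emc_or_absorb a b) ab.
by move/mcs_mp; apply; apply: mcs_mp (EMC_M a b) _; apply/mcs_and.
Qed.

End MaximalConsistent.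

(** Otherwise [lindenbaum], applied to [a] alone, yields a maximal consistent set with [a] and
    without [b]. *)
Lemma mcs_emc_imp (P : Type) (a b : form P) :
  (forall s, mcs s -> s a -> s b) -> EMC (Imp a b).
Proof.
move=> ab; apply/der_set0/deduction; apply: contrapT.
move=> /lindenbaum [s [sP sa nsb]].
by apply: nsb; apply: ab sP _; apply: sa; left.
Qed.

Local Notation world P := {s : set (form P) | mcs s}.

(** Without [sval s a], a contradiction, whose proof set is empty and whose [Circ] is a theorem,
    would make every set a neighborhood. *)
Definition canonical_nbhd (P : Type) (s : world P) : set (set (world P)) :=
  [set X | exists a,
    [/\ sval s a, sval s (Circ a) & [set t | sval t a] `<=` X]].

(** The argument [s] only witnesses that there is a world. *)
Definition canonical_frame (P : Type) (s : world P) : frame :=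
  Frame (inhabits s) (@canonical_nbhd P).

Definition canonical_model (P : Type) (s : world P) : model P :=
  @Model P (canonical_frame s) (fun q => [set t : world P | sval t (Var q)]).

Lemma canonical_mc (P : Type) (s : world P) :
  mc_frame (canonical_frame s).
Proof.
move=> t; split=> [X Y [a [ta tCa aX]] XY|X Y [a [ta tCa aX]] [b [tb tCb bY]]].
  by exists a; split=> //; apply: subset_trans XY.
have tP := svalP t; exists (And a b); split; first exact/mcs_and.
- by apply: mcs_mp (EMC_C a b) _ => //; apply/mcs_and.
- by move=> u /= /(mcs_and (svalP u)) [ua ub]; split; [apply: aX | apply: bY].
Qed.

Lemma truth (P : Type) (s : world P) a
    (t : state (canonical_model s)) : sat a t <-> sval t a.
Proof.
elim: a t => [q|a IHa|a IHa b IHb|a IHa] t //=; have tP := svalP t.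
- by rewrite IHa (proj2 tP).
- by rewrite IHa IHb mcs_and.
have -> : [set u | sat a u] = [set u : state (canonical_model s) | sval u a].
  by apply/seteqP; split=> u /IHa.
rewrite IHa; split=> [[ta nN]|tBa].
  (* Without [Bullet a], the set [t] contains [Circ a], and [a] itself witnesses the
     neighborhood. *)
  apply: contrapT => /(proj2 tP) tCa.
  by apply: nN; exists a; split.
split=> [|[b [tb tCb ba]]]; first exact: mcs_mp (EMC_E a) tBa.
(* [Circ a] is the negation of [Bullet a], which is in [t]. *)
suff: sval t (Circ a) by move/(proj2 tP).
apply: mcs_circ_mono tb tCb => //.
by apply: mcs_emc_imp => u uP; apply: (ba (exist _ u uP)).
Qed.

Lemma emc_strongly_complete (P : Type) (p : P) :
  strongly_complete p (@EMC P) mc_frame.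
Proof.
move=> G a Ga; have [/der_finite [L LG La]|] := pselect (der G a).
  by exists L; split=> //; apply: emc_BigAnd.
(* If [a] is not derivable, a world that includes [G] and omits [a] refutes the entailment. *)
move=> /lindenbaum [s [sP Gs nsa]]; exfalso; apply: nsa.
pose t : world P := exist _ s sP.
apply/(truth (s := t) a t)/Ga; first exact: canonical_mc.
by move=> g /Gs sg; apply/truth.
Qed.

Theorem theorem5p13 (P : Type) (p : P) :
  sound (@EMC P) mc_frame /\ strongly_complete p (@EMC P) mc_frame.
Proof. by split; [apply: emc_sound | apply: emc_strongly_complete]. Qed.
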